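(* Let $n\ge1$ and $\mathcal{M}=\{1^{k_1},\ldots,n^{k_n}\}$ with all $k_i\ge1$. There exists a bijection $\phi:\mathcal{T}_{\mathcal{M}}\to\overline{\mathcal{Q}}_{\mathcal{M}}$ such that for every $T\in\mathcal{T}_{\mathcal{M}}$, $$cdes(T)=des(\phi(T)),\quad first(T)=first(\phi(T)),\quad last(T)=last(\phi(T)).$$
   Context: $\mathcal{M}$ is the multiset in which $i$ occurs exactly $k_i$ times. A permutation of $\mathcal{M}$ is a word with each $i$ occurring exactly $k_i$ times; it is quasi-Stirling if there are no indices $i<j<k<\ell$ with $\pi_i=\pi_k$ and $\pi_j=\pi_\ell$. $\overline{\mathcal{Q}}_{\mathcal{M}}$ is the set of quasi-Stirling permutations of $\mathcal{M}$. For a word $\pi=\pi_1\cdots\pi_N$, $des(\pi)=|\{i:1\le i\le N-1,\ \pi_i>\pi_{i+1}\}|+1$; $first(\pi)=\pi_1$, $last(\pi)=\pi_N$. An ordered tree is a rooted tree in which the children of each vertex are linearly ordered (left to right); the level of a vertex is its distance from the root. $\mathcal{T}_{\mathcal{M}}$ is the set of ordered trees whose vertices are labeled by the elements of the multiset $\{0\}\cup\mathcal{M}$ (each label used exactly as often as its multiplicity), such that: the root is labeled $0$; and every vertex at odd level with label $i$ has exactly $k_i-1$ children, all labeled $i$. (Trees are considered up to label-preserving isomorphism of ordered trees.) For a vertex $u$ with children $v_1,\ldots,v_\ell$ from left to right, $cdes(u)$ is the number of cyclic descents of the label sequence $u v_1\cdots v_\ell$, i.e. the number of positions $j$ with $w_j>w_{j+1}$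 in $w=uv_1\cdots v_\ell$, with the convention that the entry after the last is the first (so a leaf has $cdes(u)=0$). $cdes(T)=\sum_{u}cdes(u)$ over all vertices $u$ of $T$, except that $cdes(T)=1$ if $T$ has only one vertex. $first(T)$ (resp. $last(T)$) is the label of the leftmost (resp. rightmost) child of the root, with $first(T)=+\infty$, $last(T)=-\infty$ if $T$ has one vertex.
   Formalization: Quasi-Stirling is taken to mean no i<j<k<ℓ with π_i=π_k, π_j=π_ℓ and π_i≠π_j; without π_i≠π_j, any word with a letter occurring four times is excluded and the claim fails (n=1, k_1=4). *)

(* Defs.v *)
From mathcomp Require Import all_boot constructive_ereal.

Set Implicit Arguments.
Unset Strict Implicit.
Unset Printing Implicit Defensive.

(* The multiset {1^(k 1), ..., n^(k n)}, as a list; only the values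
   k 1, ..., k n are used. *)
Definition mset (n : nat) (k : nat -> nat) : seq nat :=
  flatten [seq nseq (k i) i | i <- iota 1 n].

(* The condition pi_i <> pi_j (pattern avoidance of 1212 and 2121) is part of
   the definition: otherwise no word with four equal letters would qualify. *)
Definition quasi_stirling (w : seq nat) : bool :=
  [forall a : 'I_(size w), forall b : 'I_(size w),
   forall c : 'I_(size w), forall d : 'I_(size w),
   ~~ [&& a < b, b < c, c < d,
          nth 0 w a == nth 0 w c, nth 0 w b == nth 0 w d
        & nth 0 w a != nth 0 w b]].

Definition quasi_stirling_perm (n : nat) (k : nat -> nat) : Type :=
  {w : seq nat | perm_eq w (mset n k) && quasi_stirling w}.

Definition des (w : seq nat) : nat :=
  #|[set i : 'I_(size w).-1 | nth 0 w i > nth 0 w i.+1]| + 1.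

(* The default 0 is only reached on the empty word. *)
Definition first_letter (w : seq nat) : nat := head 0 w.
Definition last_letter (w : seq nat) : nat := last 0 w.

(* Leibniz equality on this type is label-preserving isomorphism of ordered
   trees. *)
Inductive otree : Type := Node of nat & seq otree.

Definition label (t : otree) : nat := let: Node x _ := t in x.
Definition children (t : otree) : seq otree := let: Node _ ts := t in ts.

(* A vertex of a tree is listed as the pair of its level and the subtree of its
   descendants, when the root has level lvl. *)
Fixpoint vertices_from (lvl : nat) (t : otree) : seq (nat * otree) :=
  let: Node _ ts := t in
  (lvl, t) :: flatten [seq vertices_from lvl.+1 c | c <- ts].

Definition vertices (t : otree) : seq (nat * otree) := vertices_from 0 t.

Definition odd_level_condition (k : nat -> nat) (v : nat * otree) : bool :=
  odd v.1 ==>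
    (size (children v.2) == k (label v.2) - 1) &&
    all (fun c => label c == label v.2) (children v.2).

Definition labeled_tree (n : nat) (k : nat -> nat) : Type :=
  {t : otree |
    [&& perm_eq [seq label v.2 | v <- vertices t] (0 :: mset n k),
        label t == 0
      & all (odd_level_condition k) (vertices t)]}.

Definition cyclic_descents (w : seq nat) : nat :=
  #|[set j : 'I_(size w) | nth 0 w j > nth 0 w (ordS j)]|.

Definition cdes_vertex (u : otree) : nat :=
  cyclic_descents (label u :: [seq label c | c <- children u]).

Definition cdes (t : otree) : nat :=
  if size (vertices t) == 1 then 1
  else \sum_(v <- vertices t) cdes_vertex v.2.

Definition first_tree (t : otree) : \bar nat :=
  if children t is c :: _ then EFin (label c) else EPInf nat.

Definition last_tree (t : otree) : \bar nat :=
  if children t is c :: cs then EFin (label (last c cs)) else ENInf nat.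

(* Main.v *)
Require Import Defs.
From mathcomp Require Import all_boot constructive_ereal zify.

Set Implicit Arguments.
Unset Strict Implicit.
Unset Printing Implicit Defensive.

(** Read an odd-level vertex before its descendants and an even-level vertex
    after them.  The subtree of the odd-level vertex with label [i] and children
    [c_1, ..., c_m] (all labeled [i]) then contributes [i W_1 i W_2 ... W_m i],
    where [W_j] comes from the subtrees of the children of [c_j]; each such
    factor begins and ends with [i].  So the descents read around [W_j], from
    the [i] before it to the [i] after it, are the cyclic descents of the vertex
    [c_j], and the final descent counted by [des] is the return to the root.
    Counting labels shows that every label occurs at exactly one odd-level
    vertex, which makes the word quasi-Stirling.  Conversely a word [i u i w]
    with [i] not in [u] is quasi-Stirling only if [u] and [i w] are and share no
    letter, so it can be parsed back recursively. *)

(* [b] tells whether the root of [t] is at an odd level. *)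
Fixpoint word (b : bool) (t : otree) : seq nat :=
  let: Node x ts := t in
  let s := flatten [seq word (~~ b) c | c <- ts] in
  if b then x :: s else rcons s x.

Definition words (b : bool) (F : seq otree) : seq nat :=
  flatten [seq word b t | t <- F].

Fixpoint parity_vertices (b : bool) (t : otree) : seq (bool * otree) :=
  let: Node _ ts := t in
  (b, t) :: flatten [seq parity_vertices (~~ b) c | c <- ts].

Definition forest_vertices (b : bool) (F : seq otree) : seq (bool * otree) :=
  flatten [seq parity_vertices b t | t <- F].

Definition odd_arities (b : bool) (F : seq otree) : seq (nat * nat) :=
  [seq (label v.2, size (children v.2)) | v <- forest_vertices b F & v.1].

Definition monochrome_vertex (v : bool * otree) : bool :=
  v.1 ==> all (fun c => label c == label v.2) (children v.2).

Definition monochrome (F : seq otree) : bool :=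
  all monochrome_vertex (forest_vertices true F).

(** * Recursion on forests by the first grandchild *)

Lemma words_leaf i ts : words true (Node i [::] :: ts) = i :: words true ts.
Proof. by []. Qed.

Lemma words_cons i cs ts :
  words true (Node i cs :: ts) = i :: words false cs ++ words true ts.
Proof. by []. Qed.

Lemma words_node i j U cs ts :
  words true (Node i (Node j U :: cs) :: ts) =
  i :: words true U ++ j :: words false cs ++ words true ts.
Proof. by rewrite /words /= -/(words true U) -!cats1 -!catA. Qed.

(* Peeling off the first grandchild together with its parent mirrors the
   factorization [i u i w] of a word at the second occurrence of its first
   letter. *)
Lemma odd_forest_ind (Q : seq otree -> Prop) :
  Q [::] ->
  (forall i ts, Q ts -> Q (Node i [::] :: ts)) ->
  (forall i j U cs ts, Q U -> Q (Node i cs :: ts) ->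
     Q (Node i (Node j U :: cs) :: ts)) ->
  forall F, Q F.
Proof.
(* [Node i cs :: ts] is not a subterm of the given forest, but its word is shorter. *)
move=> Q0 Q1 Q2 F; have [n] := ubnP (size (words true F)).
elim: n F => // n IH [|[i [|[j U] cs]] ts] //.
  by rewrite words_leaf ltnS => /IH; apply: Q1.
rewrite words_node /= !size_cat /= size_cat => le_n.
by apply: Q2; apply: IH; rewrite ?words_cons /= ?size_cat; lia.
Qed.

Lemma forest_vertices_cons i cs ts :
  forest_vertices true (Node i cs :: ts) =
  (true, Node i cs) :: forest_vertices false cs ++ forest_vertices true ts.
Proof. by []. Qed.

Lemma forest_vertices_node i j U cs ts :
  forest_vertices true (Node i (Node j U :: cs) :: ts) =
  (true, Node i (Node j U :: cs)) :: (false, Node j U) ::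
    forest_vertices true U ++ forest_vertices false cs ++ forest_vertices true ts.
Proof. by rewrite /forest_vertices /= -!catA. Qed.

Lemma odd_arities_node i j U cs ts :
  odd_arities true (Node i (Node j U :: cs) :: ts) =
  (i, (size cs).+1) :: odd_arities true U ++ odd_arities false cs
    ++ odd_arities true ts.
Proof.
by rewrite /odd_arities forest_vertices_node /= !filter_cat !map_cat.
Qed.

Lemma odd_arities_cons i cs ts :
  odd_arities true (Node i cs :: ts) =
  (i, size cs) :: odd_arities false cs ++ odd_arities true ts.
Proof. by rewrite /odd_arities /= filter_cat map_cat. Qed.

Lemma monochrome_leaf i ts : monochrome (Node i [::] :: ts) = monochrome ts.
Proof. by []. Qed.

Lemma monochrome_node i j U cs ts :
  monochrome (Node i (Node j U :: cs) :: ts) =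
  [&& j == i, monochrome U & monochrome (Node i cs :: ts)].
Proof.
rewrite /monochrome forest_vertices_node /= /monochrome_vertex /= !all_cat.
by rewrite -!andbA; do !bool_congr.
Qed.

(** * Letter counts and odd-level vertices *)

Lemma perm_words F :
  perm_eq (words true F) [seq label v.2 | v <- forest_vertices true F].
Proof.
elim/odd_forest_ind: F => [|i ts IH|i j U cs ts IHU IH] //.
  by rewrite /= perm_cons.
rewrite forest_vertices_node words_node /= perm_cons perm_catC /= perm_cons.
rewrite perm_sym map_cat perm_catC perm_cat // perm_sym //.
by move: IH; rewrite words_cons /= perm_cons.
Qed.

(** Every even-level vertex repeats the label of its odd-level parent, so an odd-level vertex with
    [m] children accounts for [m + 1] copies of its label. *)
Lemma count_words a F :
  monochrome F ->
  count_mem a (words true F) = \sum_(p <- odd_arities true F | p.1 == a) p.2.+1.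
Proof.
elim/odd_forest_ind: F => [|i ts IH|i j U cs ts IHU IH]; first by rewrite big_nil.
  by rewrite odd_arities_cons monochrome_leaf big_cons /= => /IH ->; case: eqP.
rewrite monochrome_node => /and3P[/eqP-> /IHU {}IHU /IH {IH}].
rewrite odd_arities_node odd_arities_cons words_node words_cons.
rewrite !big_cons !big_cat /= !count_cat /= count_cat IHU.
by case: eqP => _; lia.
Qed.

Lemma mem_odd_labels F :
  monochrome F -> unzip1 (odd_arities true F) =i words true F.
Proof.
move=> monoF a; rewrite -[RHS]has_pred1 has_count count_words // lt0n.
rewrite sum_nat_seq_neq0; apply/mapP/hasP => [[p pO ->]|[p pO /andP[/eqP <-]]].
  by exists p; rewrite //= eqxx.
by exists p.
Qed.

(** When the labels are distinct, the sum in [count_words] has a single term. *)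
Lemma arity_count F p :
  monochrome F -> uniq (unzip1 (odd_arities true F)) ->
  p \in odd_arities true F -> p.2 = count_mem p.1 (words true F) - 1.
Proof.
move=> monoF uF pO; rewrite count_words //.
elim: (odd_arities true F) uF pO => // q s IH /= /andP[q1s us].
rewrite inE => /predU1P[->|ps].
  rewrite big_cons eqxx big1_seq ?addn0 ?subn1 // => r /andP[/eqP rq rs].
  by rewrite -rq map_f in q1s.
rewrite big_cons ifN -?IH //; apply: contraNneq q1s => ->; exact: map_f.
Qed.

(** * Words without crossings *)

Definition crossing_free (w : seq nat) : Prop :=
  forall x y, subseq [:: x; y; x; y] w -> x = y.

Lemma subseq4P (x0 x y z t : nat) (w : seq nat) :
  reflect (exists a b c d, [/\ a < b, b < c, c < d & d < size w] /\
             [:: x; y; z; t] = [seq nth x0 w i | i <- [:: a; b; c; d]])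
          (subseq [:: x; y; z; t] w).
Proof.
apply: (iffP idP) => [|[a [b [c [d [[ab bc cd dw] ->]]]]]].
  (* [w] is the image of [iota 0 (size w)] under [nth], so the mask selects positions, and these are
     increasing because [iota] is. *)
  move=> /subseqP[m sz_m]; rewrite -{1}(mkseq_nth x0 w) -map_mask.
  have := sorted_mask ltn_trans m (iota_ltn_sorted 0 (size w)).
  have: {subset mask m (iota 0 (size w)) <= iota 0 (size w)}.
    by move=> i; apply: mem_mask.
  case: (mask _ _) => [|a [|b [|c [|d [|]]]]] // lt_w.
  move=> /= /and4P[ab bc cd _] E; exists a, b, c, d; split=> //; split=> //.
  by have := lt_w d; rewrite !inE eqxx !orbT mem_iota => /(_ isT).
rewrite -{2}(mkseq_nth x0 w); apply: map_subseq.
suff -> : [:: a; b; c; d] = [seq i <- iota 0 (size w) | i \in [:: a; b; c; d]].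
  exact: filter_subseq.
apply: (irr_sorted_eq ltn_trans ltnn).
- by rewrite /= ab bc cd.
- by apply: sorted_filter; [apply: ltn_trans | apply: iota_ltn_sorted].
by move=> i; rewrite mem_filter mem_iota !inE; lia.
Qed.

Lemma quasi_stirlingP w : reflect (crossing_free w) (quasi_stirling w).
Proof.
apply: (iffP idP) => [qs x y /(subseq4P 0)|cf].
  case=> [a [b [c [d [[ab bc cd dw] [xa yb xc yd]]]]]].
  have cw := ltn_trans cd dw; have bw := ltn_trans bc cw.
  have aw := ltn_trans ab bw.
  move/forallP/(_ (Ordinal aw))/forallP/(_ (Ordinal bw)): qs.
  move/forallP/(_ (Ordinal cw))/forallP/(_ (Ordinal dw)).
  by rewrite /= ab bc cd -xa -yb -xc -yd !eqxx /= negbK => /eqP.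
do 4!apply/forallP => ?; apply/negP => /and5P[ab bc cd /eqP ac /andP[/eqP bd]].
case/eqP; apply: cf; apply/(subseq4P 0).
by do 4!eexists; split; first split; [apply: ab|apply: bc|apply: cd| |rewrite /= ac bd].
Qed.

Lemma crossing_free_sub w w' : subseq w w' -> crossing_free w' -> crossing_free w.
Proof. by move=> sub cf x y xyw; apply: cf; apply: subseq_trans sub. Qed.

Lemma subseq_cons_notin (x : nat) s u v :
  x \notin u -> subseq (x :: s) (u ++ v) = subseq (x :: s) v.
Proof.
by elim: u => // y u IH; rewrite inE negb_or => /andP[/negPf /= -> /IH].
Qed.

Lemma crossing_free_cons i w :
  i \notin w -> crossing_free w -> crossing_free (i :: w).
Proof.
move=> iw cf x y; rewrite [subseq _ _]/=; case: eqP => [->|_ /cf//].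
move=> /mem_subseq/(_ i); rewrite !inE eqxx orbT => /(_ isT).
by rewrite (negPf iw).
Qed.

Lemma crossing_free_nest i u w :
  i \notin u ->
  crossing_free (i :: u ++ i :: w) <->
  [/\ crossing_free u, crossing_free (i :: w) & ~~ has (mem u) w].
Proof.
move=> iu; split=> [cf|[cfu cfw /hasPn uw]].
  split.
  - apply: crossing_free_sub cf; apply: subseq_trans (subseq_cons _ _).
    exact: prefix_subseq.
  - apply: crossing_free_sub cf; apply: subseq_trans (subseq_cons _ _).
    exact: suffix_subseq.
  (* A letter [x] common to [u] and [w] would give the pattern [i x i x], hence [x = i], although
     [i] is not in [u]. *)
  apply/hasPn => x xw; apply: contraNN iu => /= xu.
  suff -> : i = x by [].
  apply: cf; rewrite /= eqxx -[[:: x; i; x]]/([:: x] ++ [:: i; x]).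
  by apply: cat_subseq; rewrite ?sub1seq //= eqxx sub1seq.
have neq_i x : x \in u -> i == x = false.
  by move=> xu; apply: contraNF iu => /eqP->.
have notin_iw x : x \in u -> x \notin i :: w.
  move=> xu; rewrite inE eq_sym neq_i //=.
  by apply/negP => /uw /=; rewrite xu.
move=> x y xyxy; have [//|neq_xy] := eqVneq x y.
(* If both letters lie in [u], filtering by the letters of [u] leaves only [u]. If one does,
   matching the other letter pushes the rest of the pattern past [u], where the letter of [u] does
   not occur. If neither does, [u] can be skipped. *)
have [xu|xu] := boolP (x \in u); have [yu|yu] := boolP (y \in u).
- apply: cfu; have : subseq [:: x; y; x; y] (filter (mem u) (i :: u ++ i :: w)).
    by rewrite subseq_filter /= xu yu.
  rewrite /= (negPf iu) filter_cat /= (negPf iu).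
  rewrite (all_filterP (introT allP _)) => [|//].
  suff -> : filter (mem u) w = [::] by rewrite cats0.
  by apply/eqP; rewrite -[_ == _]negbK -has_filter; apply/hasPn.
- move: xyxy; rewrite /= eq_sym neq_i // => /cons_subseq.
  rewrite subseq_cons_notin // => /mem_subseq/(_ x).
  by rewrite (negPf (notin_iw _ xu)) !inE eqxx ?orbT => /(_ isT).
- move/cons_subseq: xyxy; rewrite /= eq_sym neq_i //.
  move=> /cons_subseq; rewrite subseq_cons_notin // => /mem_subseq/(_ y).
  by rewrite (negPf (notin_iw _ yu)) !inE eqxx ?orbT => /(_ isT).
apply: cfw; move: xyxy; rewrite [subseq _ _]/=; case: eqP => [<-|_].
  rewrite subseq_cons_notin //=.
  by rewrite eq_sym (negPf neq_xy); case: (x =P x).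
by rewrite subseq_cons_notin.
Qed.

(** * Forests with distinct odd-level labels *)

(** A condition free of [k]: for words with the right letter counts, distinct labels at odd levels
    replace the prescribed arities ([labeled_treeE]). *)
Definition good_forest (F : seq otree) : bool :=
  monochrome F && uniq (unzip1 (odd_arities true F)).

Lemma good_forest_leaf i ts :
  good_forest (Node i [::] :: ts) = (i \notin words true ts) && good_forest ts.
Proof.
rewrite /good_forest monochrome_leaf odd_arities_cons /=.
by case: (boolP (monochrome ts)) => [mono|]; rewrite ?andbF // -mem_odd_labels.
Qed.

(** The counterpart of [crossing_free_nest] for forests; the disjointness clause includes that [i]
    is not a letter of [U]. *)
Lemma good_forest_node i j U cs ts :
  good_forest (Node i (Node j U :: cs) :: ts) =
  [&& j == i, good_forest U, good_forest (Node i cs :: ts)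
    & ~~ has (mem (words true U)) (words true (Node i cs :: ts))].
Proof.
rewrite /good_forest monochrome_node.
case: (boolP (monochrome U)) => [monoU|]; rewrite ?andbF //.
case: (boolP (monochrome (Node i cs :: ts))) => [mono|]; rewrite ?andbF //.
rewrite -(eq_has (mem_odd_labels monoU)) -(eq_has_r (mem_odd_labels mono)).
rewrite odd_arities_node odd_arities_cons /= andbT; case: (j == i) => //=.
rewrite /unzip1 map_cat; set X := map _ _; set Y := map _ _.
by rewrite -[LHS]/(uniq ([:: i] ++ X ++ Y)) uniq_catCA cat_uniq andbCA andbC andbA.
Qed.

Lemma good_forest_crossing_free F :
  good_forest F -> crossing_free (words true F).
Proof.
elim/odd_forest_ind: F => [_ x y //|i ts IH|i j U cs ts IHU IH].
  rewrite good_forest_leaf words_leaf => /andP[i_ts /IH].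
  exact: crossing_free_cons.
rewrite good_forest_node => /and4P[/eqP-> /IHU cfU /IH cf dis].
rewrite words_node; move: cf dis; rewrite words_cons /= negb_or.
by move=> cf /andP[iU dis]; apply/crossing_free_nest.
Qed.

(** * Parsing a word into a forest *)

(* [n] is fuel: any bound on the size of [w] gives the same result. *)
Fixpoint parse (n : nat) (w : seq nat) : seq otree :=
  if (n, w) is (n'.+1, i :: w') then
    if i \in w' then
      if parse n' (drop (index i w') w') is Node _ cs :: ts then
        Node i (Node i (parse n' (take (index i w') w')) :: cs) :: ts
      else [::]
    else Node i [::] :: parse n' w'
  else [::].

Lemma wordsK n F :
  good_forest F -> size (words true F) <= n -> parse n (words true F) = F.
Proof.
elim/odd_forest_ind: F n => [[]|i ts IH|i j U cs ts IHU IH] // n.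
  rewrite good_forest_leaf words_leaf => /andP[i_ts good].
  by case: n => // n le_n /=; rewrite (negPf i_ts) IH.
rewrite good_forest_node => /and4P[/eqP-> goodU good dis].
rewrite words_node; case: n => // n; rewrite /= size_cat /= size_cat => le_n.
(* Since [i] is not a letter of [U], its next occurrence is the letter of the first child, and the
   cut falls right after the word of [U]. *)
move: (dis); rewrite words_cons /= negb_or => /andP[iU _].
rewrite mem_cat mem_head orbT index_cat (negPf iU) /= eqxx addn0.
rewrite take_size_cat // drop_size_cat // -words_cons.
by rewrite IH ?IHU // ?words_cons /= ?size_cat; lia.
Qed.

Lemma parse_spec n w :
  size w <= n ->
  [/\ words true (parse n w) = w, monochrome (parse n w)
    & crossing_free w -> good_forest (parse n w)].
Proof.
elim: n w => [[]|n IH [|i w]] // le_iw.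
have {le_iw} le_w : size w <= n by []; rewrite /=.
case: ifPn => [iw|iw]; last first.
  have [E mono good] := IH w le_w; rewrite words_leaf E monochrome_leaf.
  split=> // cf; rewrite good_forest_leaf E iw good //.
  exact: crossing_free_sub (subseq_cons _ _) cf.
have [u [v [Ew iu]]] : exists u v : seq nat, w = u ++ i :: v /\ i \notin u.
  exists (take (index i w) w), (drop (index i w).+1 w).
  by rewrite -drop_index // cat_take_drop in_take // ltnn.
move: le_w; rewrite Ew index_cat (negPf iu) /= eqxx addn0.
rewrite take_size_cat // drop_size_cat // size_cat => le_w.
have [Eu monou goodu] := IH u (leq_trans (leq_addr _ _) le_w).
have := IH (i :: v) (leq_trans (leq_addl _ _) le_w).
(* The forest parsed from [i :: v] has that word, so it is nonempty and its first root is [i]; the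
   fallback [[::]] in [parse] does not arise here. *)
case: (parse n (i :: v)) => [|[j cs] ts] [] //.
rewrite words_cons => -[-> E] monov goodv.
rewrite words_node monochrome_node Eu E eqxx monou monov; split=> // cf.
have /(crossing_free_nest _ iu)[cfu cfv dis] := cf.
rewrite good_forest_node eqxx goodu // goodv // Eu words_cons E /=.
by rewrite negb_or iu.
Qed.

(** * Descents and cyclic descents *)

Definition descents (x : nat) (s : seq nat) : nat :=
  count id (pairmap (fun a b => b < a) x s).

Lemma descents_cat x s1 s2 :
  descents x (s1 ++ s2) = descents x s1 + descents (last x s1) s2.
Proof. by rewrite /descents pairmap_cat count_cat. Qed.

Lemma descents_cons x y s : descents x (y :: s) = (y < x) + descents y s.
Proof. by []. Qed.

Lemma card_descents x s :
  #|[set i : 'I_(size s) | nth 0 (x :: s) i > nth 0 s i]| = descents x s.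
Proof.
transitivity (\sum_(i < size s) (nth 0 s i < nth 0 (x :: s) i)).
  by rewrite -sum1dep_card big_mkcond; apply: eq_bigr => i _; case: ifP.
elim: s x => [|y s IH] x; first by rewrite big_ord0.
by rewrite big_ord_recl descents_cons -IH.
Qed.

Lemma desE x s : des (x :: s) = descents x s + 1.
Proof. by rewrite -card_descents. Qed.

Lemma cyclic_descentsE x s : cyclic_descents (x :: s) = descents x (rcons s x).
Proof.
rewrite -card_descents size_rcons /cyclic_descents; apply: eq_card => i.
rewrite !inE -rcons_cons !nth_rcons /= ltn_ord.
have := ltn_ord i; rewrite ltnS leq_eqVlt => /predU1P[->|lt_i].
  by rewrite modnn ltnn eqxx.
by rewrite modn_small ?ltnS // lt_i.
Qed.

(** Odd-level vertices have no cyclic descents, their label sequences being constant. The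
    surrounding [x] and [s] are arbitrary so that the induction hypothesis applies to [U] read
    between two letters [i]. *)
Lemma descents_words x F s :
  monochrome F ->
  descents x (words true F ++ s) =
  descents x ([seq label t | t <- F] ++ s) +
    \sum_(v <- forest_vertices true F) cdes_vertex v.2.
Proof.
have mono_cdes i cs : all (fun c => label c == i) cs -> cdes_vertex (Node i cs) = 0.
  rewrite /cdes_vertex cyclic_descentsE /= -cats1.
  elim: cs => [|c cs IH] /=; rewrite descents_cons ?ltnn // => /andP[/eqP-> /IH ->].
  by rewrite ltnn.
elim/odd_forest_ind: F x s => [|i ts IH|i j U cs ts IHU IH] x s.
- by rewrite big_nil addn0.
- rewrite monochrome_leaf words_leaf => mono.
  rewrite /= !descents_cons IH // big_cons [cdes_vertex _]mono_cdes //.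
  by rewrite add0n addnA.
move=> monoF; move: (monoF).
rewrite monochrome_node => /and3P[/eqP ji monoU mono]; rewrite ji in monoF *.
have [monoi _] := andP monoF; have [monoi' _] := andP mono.
rewrite words_node forest_vertices_node !big_cons (mono_cdes i (Node i U :: cs)) //.
set X := words false cs ++ words true ts.
(* Read from the preceding [i], the factor [words true U ++ [:: i]] gives the cyclic descents of
   [Node i U] plus those inside [U]. *)
have -> : (i :: words true U ++ i :: X) ++ s = i :: (words true U ++ [:: i]) ++ X ++ s.
  by rewrite /= -!catA /= catA.
have := IH i s mono; rewrite words_cons forest_vertices_cons big_cons /=.
rewrite (mono_cdes i cs) // -/X.
rewrite !descents_cons ltnn (descents_cat i (_ ++ [:: i])) last_cat /= IHU // add0n => ->.
rewrite [cdes_vertex (Node i U)]/cdes_vertex cyclic_descentsE -cats1 /= !big_cat /=.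
by lia.
Qed.

(** The factor of an odd-level vertex ends with its own label, read at the vertex itself or at its
    last child. *)
Lemma last_words x F :
  monochrome F -> last x (words true F) = last x [seq label t | t <- F].
Proof.
elim/odd_forest_ind: F x => [|i ts IH|i j U cs ts _ IH] x //.
  by rewrite monochrome_leaf words_leaf => /IH /= ->.
rewrite monochrome_node words_node => /and3P[/eqP-> _ /(IH i)].
by rewrite words_cons; set X := _ ++ _; rewrite /= last_cat => /= ->.
Qed.

(** * Labeled trees described by their words *)

Lemma vertices_fromE l t :
  [seq (odd v.1, v.2) | v <- vertices_from l t] = parity_vertices (odd l) t.
Proof.
move: l t; fix IH 2 => l [x ts] /=; congr (_ :: _).
rewrite map_flatten -map_comp; congr flatten.
by elim: ts => //= t ts ->; rewrite IH.
Qed.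

Lemma vertices_rootE x F :
  [seq (odd v.1, v.2) | v <- vertices (Node x F)] =
  (false, Node x F) :: forest_vertices true F.
Proof. exact: vertices_fromE. Qed.

Definition odd_condition (k : nat -> nat) (v : bool * otree) : bool :=
  v.1 ==>
    (size (children v.2) == k (label v.2) - 1) &&
    all (fun c => label c == label v.2) (children v.2).

Lemma all_odd_condition k F :
  all (odd_condition k) (forest_vertices true F) =
  monochrome F && all (fun p => p.2 == k p.1 - 1) (odd_arities true F).
Proof.
rewrite /monochrome all_map all_filter -all_predI; apply: eq_all => -[b t] /=.
by rewrite /odd_condition /monochrome_vertex /=; case: b; rewrite //= andbC.
Qed.

Lemma count_mset n k i : count_mem i (mset n k) = (0 < i <= n) * k i.
Proof.
rewrite /mset count_flatten -map_comp.
rewrite (eq_map (g := fun j => (j == i) * k i)) => [|j]; last first.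
  by rewrite /= count_nseq /=; case: eqP => [->|].
rewrite sumnE big_map -big_distrl /= -[i in RHS]/i; congr (_ * _).
rewrite -big_mkcond /= sum1_count count_uniq_mem ?iota_uniq // mem_iota.
by rewrite add1n ltnS.
Qed.

(** Only the arities need an argument: distinct odd-level labels force them through [arity_count],
    and the converse counts the vertices with a given label. *)
Lemma labeled_treeE n k x F :
  (forall i : nat, 1 <= i <= n -> 1 <= k i) ->
  [&& perm_eq [seq label v.2 | v <- vertices (Node x F)] (0 :: mset n k),
      label (Node x F) == 0
    & all (odd_level_condition k) (vertices (Node x F))] =
  [&& x == 0, perm_eq (words true F) (mset n k) & good_forest F].
Proof.
move=> k_gt0.
have -> : [seq label v.2 | v <- vertices (Node x F)] =
          x :: [seq label v.2 | v <- forest_vertices true F].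
  by have /(congr1 (map (label \o snd))) := vertices_rootE x F; rewrite -map_comp.
have -> : all (odd_level_condition k) (vertices (Node x F)) =
          all (odd_condition k) (forest_vertices true F).
  by have /(congr1 (all (odd_condition k))) := vertices_rootE x F; rewrite all_map.
rewrite andbCA; case: eqP => //= ->; rewrite perm_cons.
rewrite -(permPl (perm_words F)) all_odd_condition.
case: (boolP (perm_eq _ _)) => //= /permP perm_w.
rewrite /good_forest; case: (boolP (monochrome F)) => //= mono.
apply/idP/idP => [arities|uF]; last first.
  apply/allP => p pO; rewrite (arity_count mono uF pO) perm_w count_mset.
  have : p.1 \in words true F by rewrite -mem_odd_labels // map_f.
  by rewrite -has_pred1 has_count perm_w count_mset; case: (_ && _); rewrite ?mul1n.
(* Each odd-level vertex labeled [i] accounts for [(k i - 1).+1] letters, which is [k i] by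
   positivity; as there are [k i] letters in all, there is one such vertex. *)
have count1 i : 0 < i <= n -> count_mem i (unzip1 (odd_arities true F)) = 1.
  move=> i_n; have := perm_w (pred1 i).
  rewrite count_words // count_mset i_n mul1n count_map -sum1_count.
  rewrite big_seq_cond (eq_bigr (fun=> 1 * k i)) => [|p /andP[pO /eqP pi]].
    rewrite -big_distrl -big_seq_cond /= -[RHS]mul1n => /eqP.
    by rewrite eqn_pmul2r ?k_gt0 // => /eqP.
  rewrite (eqP (allP arities p pO)) pi mul1n subn1 prednK //; exact: k_gt0.
apply: count_mem_uniq => i; case: (boolP (i \in _)) => [iO|]; last first.
  by move/count_memPn.
rewrite count1 //; have : i \in words true F by rewrite -mem_odd_labels.
rewrite -has_pred1 has_count perm_w count_mset; by case: (_ && _).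
Qed.

(** * The bijection and its statistics *)

Theorem theorem2p1 (n : nat) (k : nat -> nat) :
  1 <= n ->
  (forall i : nat, 1 <= i <= n -> 1 <= k i) ->
  exists phi : labeled_tree n k -> quasi_stirling_perm n k,
    bijective phi /\
    forall T : labeled_tree n k,
      [/\ cdes (sval T) = des (sval (phi T)),
          first_tree (sval T) = EFin (first_letter (sval (phi T)))
        & last_tree (sval T) = EFin (last_letter (sval (phi T)))].
Proof.
move=> n_gt0 k_gt0.
have tree_word (T : labeled_tree n k) :
    {w : quasi_stirling_perm n k | sval w = words true (children (sval T))}.
  case: T => -[x F] /= P; have := P; rewrite labeled_treeE // => /and3P[_ perm_w good].
  have Q : perm_eq (words true F) (mset n k) && quasi_stirling (words true F).
    by rewrite perm_w; apply/quasi_stirlingP/good_forest_crossing_free.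
  by exists (exist _ (words true F) Q).
have word_tree (w : quasi_stirling_perm n k) :
    {T : labeled_tree n k | sval T = Node 0 (parse (size (sval w)) (sval w))}.
  case: w => w /= /andP[perm_w /quasi_stirlingP qs].
  have [E _ good] := parse_spec (leqnn (size w)).
  set T := Node 0 _.
  suff P : [&& perm_eq [seq label v.2 | v <- vertices T] (0 :: mset n k),
               label T == 0 & all (odd_level_condition k) (vertices T)].
    by exists (exist _ T P).
  by rewrite labeled_treeE // eqxx E perm_w good.
exists (fun T => sval (tree_word T)); split.
  exists (fun w => sval (word_tree w)) => [T|w]; apply: val_inj => /=.
    rewrite (svalP (word_tree _)) (svalP (tree_word T)).
    case: T => -[x F] /= P; have := P.
    by rewrite labeled_treeE // => /and3P[/eqP-> _ good]; rewrite wordsK.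
  rewrite (svalP (tree_word _)) (svalP (word_tree w)).
  by have [] := parse_spec (leqnn (size (sval w))).
move=> T; rewrite (svalP (tree_word T)); case: T => -[x F] P /=.
have := P; rewrite labeled_treeE // => /and3P[/eqP x0 perm_w /andP[mono _]].
rewrite {x P}x0.
have mem_w i : (i \in words true F) = (0 < i <= n).
  rewrite (perm_mem perm_w) -has_pred1 has_count count_mset.
  by have := k_gt0 i; case: (_ && _) => // /(_ isT); rewrite mul1n.
have last_gt0 x : x \in words true F -> 0 < last x (words true F).
  move=> xw; have : last x (words true F) \in words true F.
    by case: (words true F) xw => // y s _; apply: mem_last.
  by rewrite mem_w => /andP[].
(* As [n] is positive the forest is nonempty, so the one-vertex conventions never apply. *)
have w1 : 1 \in words true F by rewrite mem_w.
split.
- rewrite /cdes; have -> : (size (vertices (Node 0 F)) == 1) = false.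
    by case: (F) w1 => [|[]].
  transitivity (\sum_(v <- (false, Node 0 F) :: forest_vertices true F) cdes_vertex v.2).
    by rewrite -vertices_rootE big_map.
  (* Around the root the word is read from 0 back to 0: the step up from 0 is no descent, and the
     step down to 0 is the extra one in [des], since letters are positive. *)
  rewrite big_cons /= {1}/cdes_vertex cyclic_descentsE -cats1 -descents_words //.
  case: (words true F) w1 last_gt0 => // y s _ last_gt0.
  rewrite desE cat_cons descents_cons descents_cat descents_cons.
  by rewrite [0 < _](last_gt0 y) ?mem_head // addn0.
- by case: (F) w1 => [|[]].
rewrite /last_letter last_words //.
case: (F) w1 => //= c cs _; congr EFin; by rewrite last_map.
Qed.
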